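(* Let $n\ge1$ and let $b_1,\ldots,b_n,b',c_1,\ldots,c_n,c'$ be complex parameters. Let $\delta_1=t_1\,\partial/\partial t_1$, $\delta_2=(t_2-1)\,\partial/\partial t_2$, and consider the system of linear partial differential equations for $z(t_1,t_2)$ \begin{align*} &\Big[t_1(\delta_1+\delta_2+c')\Big\{\prod_{i=1}^n(\delta_1+b_i)\Big\}-\delta_1\Big\{\prod_{i=1}^n(\delta_1+c_i-1)\Big\}\Big]z=0,\\ &\{(1-t_2)(\delta_1+\delta_2+c')(\delta_2+b')-\delta_2(\delta_2+c'-1)\}z=0,\\ &\Big[t_1\delta_2\Big\{\prod_{i=1}^n(\delta_1+b_i)\Big\}+\{(1-t_2)(\delta_2+b')-\delta_2\}\Big\{\prod_{i=1}^n(\delta_1+c_i-1)\Big\}\Big]z=0. \end{align*} Let $D_1=s_1\,\partial/\partial s_1$, $D_2=s_2\,\partial/\partial s_2$, $D=D_1+D_2$, and consider the system for $y(s_1,s_2)$ \begin{align*} &\Big[s_1(D_1+\beta_1)\Big\{\prod_{i=1}^n(D+\alpha_i)\Big\}-D_1\Big\{\prod_{i=1}^n(D+\gamma_i-1)\Big\}\Big]y=0,\\ &\Big[s_2(D_2+\beta_2)\Big\{\prod_{i=1}^n(D+\alpha_i)\Big\}-D_2\Big\{\prod_{i=1}^n(D+\gamma_i-1)\Big\}\Big]y=0,\\ &\{s_1(D_1+\beta_1)D_2-s_2(D_2+\beta_2)D_1\}y=0, \end{align*} with $\alpha_i=b_i$, $\gamma_i=c_i$ ($i=1,\ldots,n$),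 $\beta_1=c'-b'$, $\beta_2=b'$. Then the first system is transformed into the second system by the change of variables \[ s_1=t_1,\qquad s_2=\frac{t_1}{t_2},\qquad y=t_2^{b'}z . \]
   Context: Products of commuting operators denote composition. ''Transformed into'' means that, after rewriting the operators in the new variables $s_1=t_1$, $s_2=t_1/t_2$ and conjugating by the factor $t_2^{b'}$, the first system becomes equivalent to the second, so that $z$ solves the first system exactly when $y=t_2^{b'}z$ solves the second. *)

(* Defs.v *)
From mathcomp Require Import all_boot all_algebra.
From mathcomp Require Import all_classical all_reals all_analysis.
From mathcomp Require Import complex.
Import GRing.Theory Num.Theory numFieldNormedType.Exports.
Import ComplexField.

Set Implicit Arguments.
Unset Strict Implicit.
Unset Printing Implicit Defensive.

Local Open Scope ring_scope.
Local Open Scope classical_set_scope.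

(* The complex numbers C = R[i] over a model R of the reals, seen as a
   numFieldType so that MathComp-Analysis' (complex) derivatives apply. *)
Definition Cplx (R : realType) : numFieldType := R[i].

Definition fn (K : numFieldType) := (K * K -> K)%type.
Definition op (K : numFieldType) := (fn K -> fn K)%type.

Section Operators.
Variable K : numFieldType.

Definition pd1 (f : fn K) : fn K := fun x => 'D_((1 : K), (0 : K)) f x.
Definition pd2 (f : fn K) : fn K := fun x => 'D_((0 : K), (1 : K)) f x.

Definition op_add (A B : op K) : op K := fun f x => A f x + B f x.
Definition op_sub (A B : op K) : op K := fun f x => A f x - B f x.
Definition op_lmul (g : fn K) (A : op K) : op K := fun f x => g x * A f x.
Definition op_shift (A : op K) (c : K) : op K := fun f x => A f x + c * f x.
Definition op_prod (n : nat) (F : 'I_n -> op K) : op K :=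
  foldr (fun i acc => F i \o acc) id (enum 'I_n).

Definition euler1 : op K := fun f x => x.1 * pd1 f x.
Definition euler2 : op K := fun f x => x.2 * pd2 f x.
Definition delta2 : op K := fun f x => (x.2 - 1) * pd2 f x.

Definition iter_pd (l : seq bool) (f : fn K) : fn K :=
  foldr (fun b g => if b then pd2 g else pd1 g) f l.

Definition smooth_on (U : set (K * K)) (f : fn K) : Prop :=
  forall (l : seq bool) (x : K * K), U x -> differentiable (iter_pd l f) x.

Definition solves3 (A B C : op K) (U : set (K * K)) (f : fn K) : Prop :=
  forall x, U x -> [/\ A f x = 0, B f x = 0 & C f x = 0].

Section System1.
Variables (n : nat) (b c : 'I_n -> K) (b' c' : K).

Definition prod_b : op K := op_prod (fun i => op_shift euler1 (b i)).
Definition prod_c : op K := op_prod (fun i => op_shift euler1 (c i - 1)).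

Definition sys1_L1 : op K :=
  op_sub (op_lmul (fun t => t.1) (op_shift (op_add euler1 delta2) c' \o prod_b))
         (euler1 \o prod_c).
Definition sys1_L2 : op K :=
  op_sub (op_lmul (fun t => 1 - t.2)
                  (op_shift (op_add euler1 delta2) c' \o op_shift delta2 b'))
         (delta2 \o op_shift delta2 (c' - 1)).
Definition sys1_L3 : op K :=
  op_add (op_lmul (fun t => t.1) (delta2 \o prod_b))
         (op_sub (op_lmul (fun t => 1 - t.2) (op_shift delta2 b')) delta2 \o prod_c).
End System1.

Section System2.
Variables (n : nat) (alpha gamma : 'I_n -> K) (beta1 beta2 : K).

Definition Dsum : op K := op_add euler1 euler2.
Definition prod_alpha : op K := op_prod (fun i => op_shift Dsum (alpha i)).
Definition prod_gamma : op K := op_prod (fun i => op_shift Dsum (gamma i - 1)).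

Definition sys2_M1 : op K :=
  op_sub (op_lmul (fun s => s.1) (op_shift euler1 beta1 \o prod_alpha))
         (euler1 \o prod_gamma).
Definition sys2_M2 : op K :=
  op_sub (op_lmul (fun s => s.2) (op_shift euler2 beta2 \o prod_alpha))
         (euler2 \o prod_gamma).
Definition sys2_M3 : op K :=
  op_sub (op_lmul (fun s => s.1) (op_shift euler1 beta1 \o euler2))
         (op_lmul (fun s => s.2) (op_shift euler2 beta2 \o euler1)).
End System2.

(* inverse of the change of variables s1 = t1, s2 = t1/t2 : t = (s1, s1/s2) *)
Definition t_of_s (s : K * K) : K * K := (s.1, s.1 / s.2).

End Operators.

(* Main.v *)
(* With theta_i = t_i d/dt_i, the substitution s1 = t1, s2 = t1/t2 turns D_1
   into theta_1 + theta_2 and D_2 into -theta_2, hence D into theta_1, and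
   conjugation by t2^(b') replaces theta_2 by theta_2 + b'.  Writing m1, m2, m3
   for the transforms of the three operators of the second system, the operators
   of the first one are
     L1 = m1 + m2,   t1 L2 = -(1 - t2) m3,   L3 = (1 - t2) m2.
   The factor 1 - t2 is harmless even on the line t2 = 1, because m2 z and m3 z
   are continuous.  Only the identity for L2 needs the mixed partial derivatives
   of z to commute; for complex differentiable functions this is obtained from
   the real mean value theorem applied to the real and imaginary parts of a
   second difference. *)
Require Import Defs.
From mathcomp Require Import all_boot all_order all_algebra.
From mathcomp Require Import all_classical all_reals all_analysis.
From mathcomp Require Import complex.
From mathcomp Require Import ring lra.
Import Order.TTheory GRing.Theory Num.Theory numFieldNormedType.Exports.
Import ComplexField.
Local Open Scope ring_scope.
Local Open Scope classical_set_scope.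

Set Implicit Arguments.
Unset Strict Implicit.

(** * Smooth functions of two variables *)

(** The differential of [f] at [x] is also a first-order expansion of [g] there, and [diff_unique]
    identifies it with that of [g]. *)
Lemma near_eq_differentiable (K : numFieldType) (V W : normedModType K)
    (f g : V -> W) (x : V) :
  (\near x, f x = g x) -> differentiable f x -> differentiable g x.
Proof.
move=> fg df; have [cf /eqaddoP fe] := (diff_locallyP _ _).1 df.
have fg0 : \forall h \near 0, f (h + x) = g (h + x).
  by move: (fg); rewrite (near_shift 0) /= subr0.
have dg : g \o shift x = cst (g x) + 'd f x +o_ 0 id.
  apply/eqaddoP => e e0; apply: filterS2 (fg0) (fe e e0).
  by move=> h /= fgh; rewrite !fctE /= fgh (nbhs_singleton fg).
by apply/diff_locallyP; rewrite (diff_unique cf dg).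
Qed.

Section SmoothFunctions.
Variable K : numFieldType.
Implicit Types (U : set (K * K)) (f g : fn K) (x v : K * K) (k : nat).

Lemma eq_on_derive U f g v x : open U -> U x -> (forall y, U y -> f y = g y) ->
  'D_v f x = 'D_v g x.
Proof.
move=> oU Ux fg; apply: near_eq_derive.
by apply: filterS (open_nbhs_nbhs (conj oU Ux)) => y /fg.
Qed.

Lemma diff_pdE f x v : differentiable f x ->
  'd f x v = v.1 * pd1 f x + v.2 * pd2 f x.
Proof.
move=> df; rewrite /pd1 /pd2 !deriveE//.
rewrite [in LHS](_ : v = v.1 *: ((1 : K), (0 : K)) + v.2 *: ((0 : K), (1 : K))); last first.
  by apply: injective_projections => /=;
    rewrite /GRing.scale /= !mulr0 !mulr1 ?addr0 ?add0r.
by rewrite linearD !linearZ.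
Qed.

Lemma differentiable_eq_on U f g x : open U -> U x ->
  (forall y, U y -> f y = g y) -> differentiable f x -> differentiable g x.
Proof.
move=> oU Ux fg; apply: near_eq_differentiable.
by apply: filterS (open_nbhs_nbhs (conj oU Ux)) => y /fg.
Qed.

Lemma derive_add f g x v : differentiable f x -> differentiable g x ->
  'D_v (fun t => f t + g t) x = 'D_v f x + 'D_v g x.
Proof. by move=> df dg; apply: deriveD; apply: diff_derivable. Qed.

Lemma derive_mul f g x v : differentiable f x -> differentiable g x ->
  'D_v (fun t => f t * g t) x = f x * 'D_v g x + g x * 'D_v f x.
Proof. by move=> df dg; apply: deriveM; apply: diff_derivable. Qed.

(* The head of the list in iter_pd is the derivative applied last; the Leibniz
   rule needs an induction on the derivative applied first. *)
Fixpoint Cn k U f : Prop := (forall x, U x -> differentiable f x) /\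
  if k is k'.+1 then Cn k' U (pd1 f) /\ Cn k' U (pd2 f) else True.

Lemma iter_pd_rcons l (b : bool) f :
  iter_pd (rcons l b) f = iter_pd l (if b then pd2 f else pd1 f).
Proof. by rewrite /iter_pd -cats1 foldr_cat. Qed.

Lemma smooth_onP U f : smooth_on U f <-> forall k, Cn k U f.
Proof.
split=> [sf k|Cf l x Ux].
  elim: k f sf => [|k IHk] f sf /=; split=> //; try exact: sf [::].
  by split; apply: IHk => l x Ux; [have := sf (rcons l false) x Ux
   |have := sf (rcons l true) x Ux]; rewrite iter_pd_rcons.
move: (Cf (size l)) => {Cf}; elim/last_ind: l f => [|l b IHl] f; first by case=> df _; apply: df.
rewrite size_rcons /= => -[_ [C1 C2]].
by rewrite iter_pd_rcons; case: b; apply: IHl.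
Qed.

Lemma CnW k U f : Cn k.+1 U f -> Cn k U f.
Proof.
elim: k f => [|k IHk] f; first by case.
by case=> df [/IHk C1 /IHk C2]; split.
Qed.

(** The sum and product rules are available only at points of [U], so [Cn] must survive replacing a
    function by one equal to it on [U]. *)
Lemma Cn_eq k U f g : open U -> (forall y, U y -> f y = g y) ->
  Cn k U f -> Cn k U g.
Proof.
move=> oU; elim: k f g => [|k IHk] f g fg [df Cf]; split=> //.
- by move=> x Ux; apply: (differentiable_eq_on oU Ux fg); apply: df.
- by move=> x Ux; apply: (differentiable_eq_on oU Ux fg); apply: df.
by case: Cf => C1 C2; split; [apply: IHk C1|apply: IHk C2] => y Uy;
  apply: eq_on_derive oU Uy fg.
Qed.

Lemma Cn_add k U f g : open U -> Cn k U f -> Cn k U g ->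
  Cn k U (fun t => f t + g t).
Proof.
move=> oU; elim: k f g => [|k IHk] f g [df Cf] [dg Cg].
  by split=> // x Ux; apply: differentiableD; [apply: df|apply: dg].
split; first by move=> x Ux; apply: differentiableD; [apply: df|apply: dg].
case: Cf Cg => f1 f2 [g1 g2]; split.
  apply: Cn_eq oU _ (IHk _ _ f1 g1) => y Uy.
  by rewrite /pd1 derive_add; [|apply: df|apply: dg].
apply: Cn_eq oU _ (IHk _ _ f2 g2) => y Uy.
by rewrite /pd2 derive_add; [|apply: df|apply: dg].
Qed.

Lemma Cn_mul k U f g : open U -> Cn k U f -> Cn k U g ->
  Cn k U (fun t => f t * g t).
Proof.
move=> oU; elim: k f g => [|k IHk] f g Cf Cg.
  case: Cf Cg => df _ [dg _].
  by split=> // x Ux; apply: differentiableM; [apply: df|apply: dg].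
have [[df [f1 f2]] [dg [g1 g2]]] := (Cf, Cg).
(* In a Leibniz term such as [f * pd1 g] the derivative has order only [k], so [f] and [g] are
   lowered to order [k] too. *)
move/CnW in Cf; move/CnW in Cg.
split; first by move=> x Ux; apply: differentiableM; [apply: df|apply: dg].
split.
  apply: Cn_eq oU _ (Cn_add oU (IHk _ _ Cf g1) (IHk _ _ Cg f1)) => y Uy.
  by rewrite /pd1 derive_mul; [|apply: df|apply: dg].
apply: Cn_eq oU _ (Cn_add oU (IHk _ _ Cf g2) (IHk _ _ Cg f2)) => y Uy.
by rewrite /pd2 derive_mul; [|apply: df|apply: dg].
Qed.

End SmoothFunctions.

(** * Symmetry of second derivatives *)

(** Serves to compare two mixed derivatives through one second difference [D]: each is its
    coefficient of [t^2] as [t] tends to 0 from above. *)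
Lemma quadratic_coeff_unique (R : realFieldType) (D : R -> R) (a b : R) :
  (forall e, 0 < e -> exists2 d, 0 < d & forall t, 0 < t -> t < d ->
    `|D t - t * t * a| <= t * t * (e *+ 3)) ->
  (forall e, 0 < e -> exists2 d, 0 < d & forall t, 0 < t -> t < d ->
    `|D t - t * t * b| <= t * t * (e *+ 3)) ->
  a = b.
Proof.
move=> Da Db; apply/eqP; rewrite -subr_eq0 -normr_le0 leNgt.
(* The two errors add up to [6 e t^2], half of [|a - b| t^2], which is absurd once [|a - b| > 0]. *)
apply/negP => ab; set e := `|a - b| / 12.
have e0 : 0 < e by rewrite /e; lra.
have [d1 d10 d1P] := Da e e0.
have [d2 d20 d2P] := Db e e0.
pose t := Num.min d1 d2 / 2.
have m0 : 0 < Num.min d1 d2 by rewrite lt_min d10.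
have t0 : 0 < t by rewrite divr_gt0.
have /andP[t1 t2] : (t < d1) && (t < d2) by rewrite -lt_min /t; lra.
have := d1P _ t0 t1; have := d2P _ t0 t2; move: (D t) => X H1 H2.
have : `|t * t * (a - b)| <= t * t * (e *+ 6).
  rewrite (_ : t * t * (a - b) = (X - t * t * b) - (X - t * t * a)); last by ring.
  by apply: le_trans (ler_normB _ _) _; apply: le_trans (lerD H1 H2) _; lra.
rewrite normrM gtr0_norm ?mulr_gt0// ler_pM2l ?mulr_gt0//.
rewrite /e; lra.
Qed.

(** Inserts a base value [c], so that the increments from [c] to [a] and to [b] are each compared
    with their own linear parts [p] and [q]. *)
Lemma sub_sub_shift (V : zmodType) (a b c p q : V) :
  a - b - (p - q) = (a - c - p) - (b - c - q).
Proof.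
rewrite [a - c - p]addrAC [b - c - q]addrAC [in RHS]opprB [in RHS]addrA subrK.
by rewrite !opprB addrACA [RHS]addrACA [- b - p]addrC.
Qed.

Section Schwarz.
Variable R : realType.
Local Notation C := (Cplx R).
Local Notation toC := (real_complex R : R -> C).

(* L is the real or the imaginary part. *)
Variable L : C -> R.
Hypothesis LB : forall z w : C, L (z - w) = L z - L w.
Hypothesis LZ : forall (t : R) (z : C), L (toC t * z) = t * L z.
Hypothesis Ln : forall z : C, toC `|L z| <= `|z|.

Lemma toC_lt (a b : R) : (toC a < toC b) = (a < b).
Proof. exact: ltcR. Qed.

Lemma normr_toC (a : R) : `|toC a| = toC `|a|.
Proof. by rewrite normc_def /= expr0n addr0 sqrtr_sqr. Qed.

Lemma gt0_toC (e : C) : 0 < e -> exists2 d : R, 0 < d & e = toC d.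
Proof.
move=> e0; exists (complex.Re e); first by move: e0; rewrite ltcE => /andP[].
by rewrite RRe_real// gtr0_real.
Qed.

Lemma real_part_continuous : continuous L.
Proof.
move=> z A /= [e /= e0 eA]; exists (toC e) => /= [|w]; first by rewrite toC_lt.
rewrite /ball_ /= => /(le_lt_trans (Ln _)); rewrite toC_lt LB.
exact: eA.
Qed.

Lemma toC_dnbhs0 : toC h @[h --> (0 : R)^'] --> (0 : C)^'.
Proof.
move=> A /= [e /= e0 eA]; have [d d0 ed] := gt0_toC e0.
exists d => //= h; rewrite /ball_ /= sub0r normrN => hd h0.
apply: eA; first by rewrite /ball_ /= sub0r normrN normr_toC ed toC_lt.
by apply: contra h0 => /eqP[->].
Qed.

(** Real increments are among the complex ones, and [L] is continuous and commutes with real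
    scalars, so the complex limit passes to a real one. This makes the real mean value theorem
    applicable. *)
Lemma is_derive_real_line (V : normedModType C) (f : V -> C) (q u : V) (r : R) :
  differentiable f (q + toC r *: u) ->
  is_derive r 1 (fun s : R => L (f (q + toC s *: u)))
    (L ('D_u f (q + toC r *: u))).
Proof.
move=> df; set p := q + _ in df *.
have H : h^-1 *: ((f \o shift p) (h *: u) - f p) @[h --> (0 : C)^'] --> 'D_u f p.
  exact: diff_derivable.
have H2 := cvg_comp _ _ (cvg_comp _ _ toC_dnbhs0 H) (@real_part_continuous _).
have H3 : h^-1 *: (L (f (q + toC (h *: 1 + r) *: u)) - L (f p))
    @[h --> (0 : R)^'] --> L ('D_u f p).
  apply: cvg_trans H2; apply: near_eq_cvg; near=> h.
  rewrite /= -fmorphV /=.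
  rewrite [LHS](LZ h^-1 (f (toC h *: u + p) - f p)) LB; congr (_ * (L (f _) - _)).
  rewrite /shift /p.
  by rewrite [h%:A]mulr1 rmorphD scalerDl addrCA.
apply: DeriveDef; first exact: cvgP H3.
exact: cvg_lim H3.
Unshelve. all: by end_near. Qed.

Lemma diff_small_increment (V : normedModType C) (f g : V -> C) (x : V) (e : R) :
  0 < e -> (\forall y \near x, differentiable f y) -> differentiable g x ->
  exists2 d : R, 0 < d & forall h : V, `|h| < toC d ->
    differentiable f (h + x) /\
    `|g (h + x) - g x - 'd g x h| <= toC e * `|h|.
Proof.
move=> e0 df dg; have [_ /eqaddoP ge] := (diff_locallyP _ _).1 dg.
have e0' : (0 : C) < toC e by rewrite toC_lt.
have df0 : \forall h \near 0, differentiable f (h + x).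
  by move: df; rewrite (near_shift 0) /= subr0.
have [c /= c0 cP] := nbhs_norm0P.1 (filterI df0 (ge _ e0')).
have [d d0 cd] := gt0_toC c0; exists d => // h hd.
have [|h1 h2] := cP h; first by rewrite /= cd.
split=> //; move: h2; rewrite !fctE /=.
by rewrite opprD addrA.
Qed.

(** The mean value theorem in the direction [u] turns the second difference into [t] times an
    increment of ['D_u f] by [t v], and the differential of ['D_u f] at [x] estimates that
    increment. *)
Lemma second_difference_estimate (V : normedModType C) (f : V -> C) (x u v : V)
    (e : R) : 0 < e -> `|u| <= 1 -> `|v| <= 1 ->
  (\forall y \near x, differentiable f y) -> differentiable ('D_u f) x ->
  exists2 d : R, 0 < d & forall t : R, 0 < t -> t < d ->
    `|L (f (x + toC t *: u + toC t *: v) - f (x + toC t *: u)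
         - (f (x + toC t *: v) - f x)) - t * t * L ('D_v ('D_u f) x)|
    <= t * t * (e *+ 3).
Proof.
move=> e0 u1 v1 df dg.
have [d d0 dP] := diff_small_increment e0 df dg.
(* Increments [t v + s u] with [s <= t] have norm up to [2 t], which must stay below [d]. *)
exists (d / 2); first by lra.
move=> t t0 td.
have t2d : toC (t *+ 2) < toC d by rewrite toC_lt; lra.
have t1d : toC t < toC d by rewrite toC_lt; lra.
set g := 'D_u f in dg dP *.
have t0' : toC 0 <= toC t by rewrite lecR ltW.
have nu (s : R) : 0 <= s -> s <= t -> `|toC s *: u| <= toC t.
  move=> s0 st; rewrite normrZ normr_toC ger0_norm// -[leRHS]mulr1.
  by rewrite ler_pM ?lecR.
have nv : `|toC t *: v| <= toC t.
  rewrite normrZ normr_toC gtr0_norm// -[leRHS]mulr1.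
  by rewrite ler_pM ?lecR// ltW.
have nuv (s : R) : 0 <= s -> s <= t ->
    `|toC t *: v + toC s *: u| <= toC (t *+ 2).
  by move=> s0 st; rewrite mulr2n rmorphD (le_trans (ler_normD _ _))// lerD// nu.
(* The second difference is phi t - phi 0. *)
pose phi := (fun s : R => L (f (x + toC t *: v + toC s *: u)))
          - (fun s : R => L (f (x + toC s *: u))).
have dphi (s : R) : 0 <= s -> s <= t -> is_derive s 1 phi
    (L (g (x + toC t *: v + toC s *: u)) - L (g (x + toC s *: u))).
  move=> s0 st; apply: is_deriveB; apply: is_derive_real_line.
    rewrite -addrA addrC; apply: (dP _ _).1.
    exact: le_lt_trans (nuv _ s0 st) t2d.
  rewrite addrC; apply: (dP _ _).1.
  exact: le_lt_trans (nu _ s0 st) t1d.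
have [s hs||c] := @MVT _ phi (fun s => L (g (x + toC t *: v + toC s *: u))
    - L (g (x + toC s *: u))) 0 t t0.
- by apply: dphi; rewrite ltW// (itvP hs).
- apply: derivable_within_continuous => s hs.
  by have [] := dphi s _ _; rewrite ?(itvP hs).
rewrite in_itv /= => /andP[/ltW c0 /ltW ct].
rewrite /phi !fctE /= subr0 scale0r !addr0 => phit.
have -> : L (f (x + toC t *: u + toC t *: v) - f (x + toC t *: u)
    - (f (x + toC t *: v) - f x)) =
  L (f (x + toC t *: v + toC t *: u)) - L (f (x + toC t *: u))
    - (L (f (x + toC t *: v)) - L (f x)).
  by rewrite !LB [x + _ + _]addrAC.
rewrite phit -LB mulrC.
set h1 := toC t *: v + toC c *: u; set h2 := toC c *: u.
have h1d : `|h1| < toC d.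
  exact: le_lt_trans (nuv _ c0 ct) t2d.
have h2d : `|h2| < toC d.
  exact: le_lt_trans (nu _ c0 ct) t1d.
have [_ E1] := dP _ h1d.
have [_ E2] := dP _ h2d.
(* Both [h1] and [h2] contain the unknown mean value point [c]; it drops out of [h1 - h2 = t v]. *)
have dh : 'd g x h1 - 'd g x h2 = toC t * 'D_v g x.
  by rewrite -linearB /h1 addrK linearZ deriveE.
have e1 : x + toC t *: v + h2 = h1 + x by rewrite -addrA addrC.
have e2 : x + h2 = h2 + x by rewrite addrC.
have -> : t * L (g (x + toC t *: v + h2) - g (x + h2)) - t * t * L ('D_v g x) =
    t * L (g (x + toC t *: v + h2) - g (x + h2) - toC t * 'D_v g x).
  by rewrite [in RHS]LB LZ; ring.
rewrite normrM (gtr0_norm t0) -mulrA ler_pM2l// -lecR.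
apply: le_trans (Ln _) _.
have -> : g (x + toC t *: v + h2) - g (x + h2) - toC t * 'D_v g x =
    (g (h1 + x) - g x - 'd g x h1) - (g (h2 + x) - g x - 'd g x h2).
  by rewrite -dh e1 e2; apply: sub_sub_shift.
apply: le_trans (ler_normB _ _) _.
(* The factor 3 comes from [|h1| <= 2 t] and [|h2| <= t]. *)
have -> : toC (t * (e *+ 3)) = toC e * toC (t *+ 2) + toC e * toC t.
  by rewrite -!rmorphM -rmorphD; congr toC; ring.
have e0' : 0 <= toC e by rewrite ler0c ltW.
by apply: lerD; [apply: le_trans E1 _|apply: le_trans E2 _];
  rewrite ler_wpM2l// ?nuv ?nu.
Qed.

(** The second difference is symmetric in [u] and [v], so both sides are its coefficient of
    [t^2]. *)
Lemma real_part_derive_sym (V : normedModType C) (f : V -> C) (x u v : V) :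
  `|u| <= 1 -> `|v| <= 1 -> (\forall y \near x, differentiable f y) ->
  differentiable ('D_u f) x -> differentiable ('D_v f) x ->
  L ('D_v ('D_u f) x) = L ('D_u ('D_v f) x).
Proof.
move=> u1 v1 df du dv.
apply: (@quadratic_coeff_unique R (fun t =>
  L (f (x + toC t *: u + toC t *: v) - f (x + toC t *: u)
         - (f (x + toC t *: v) - f x)))) => e e0.
  exact: second_difference_estimate.
have [d d0 dP] := second_difference_estimate e0 v1 u1 df dv.
exists d => // t t0 td; have := dP t t0 td.
rewrite (addrAC x (toC t *: v) (toC t *: u)).
suff -> : forall a p q r : C, a - p - (q - r) = a - q - (p - r) by [].
by move=> a p q r; rewrite !opprB addrACA [RHS]addrACA [- p - q]addrC.
Qed.

End Schwarz.

Lemma derive_sym (R : realType) (V : normedModType (Cplx R)) (f : V -> Cplx R)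
    (x u v : V) :
  `|u| <= 1 -> `|v| <= 1 -> (\forall y \near x, differentiable f y) ->
  differentiable ('D_u f) x -> differentiable ('D_v f) x ->
  'D_v ('D_u f) x = 'D_u ('D_v f) x.
Proof.
move=> u1 v1 df du dv; apply/eqP; rewrite eq_complex; apply/andP; split; apply/eqP.
- apply: (@real_part_derive_sym R (fun z : Cplx R => complex.Re z)) => //.
  + by move=> [a1 a2] [b1 b2].
  + by move=> t [a1 a2] /=; rewrite mul0r subr0.
  + exact: normc_ge_Re.
- apply: (@real_part_derive_sym R (fun z : Cplx R => complex.Im z)) => //.
  + by move=> [a1 a2] [b1 b2].
  + by move=> t [a1 a2] /=; rewrite mul0r addr0.
  + move=> [a1 a2]; rewrite normc_def /= lecR -[leLHS]sqrtr_sqr.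
    by rewrite ler_wsqrtr// lerDr sqr_ge0.
Qed.

(** * The change of variables *)

(* The identity t1 L2 = -(1 - t2) m3, with z12, z22 the second derivatives of z. *)
Lemma second_order_identity (A : comRingType) (t1 t2 b c z0 z1 z2 z12 z22 : A) :
  t1 * ((1 - t2) * (t1 * ((t2 - 1) * z12 + b * z1)
      + (t2 - 1) * (z2 + (t2 - 1) * z22 + b * z2) + c * ((t2 - 1) * z2 + b * z0))
    - (t2 - 1) * (z2 + (t2 - 1) * z22 + (c - 1) * z2)) =
  - (1 - t2) * (t1 * (t1 * - (t2 * z12 + b * z1) + t2 * - (z2 + t2 * z22 + b * z2)
      + c * - (t2 * z2 + b * z0)) + t1 * (t1 * z12 + (z2 + t2 * z22) + b * z2)).
Proof. ring. Qed.

Section ChangeOfVariables.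
Variable K : numFieldType.
Implicit Types (U : set (K * K)) (f g p : fn K) (t s v : K * K).

Lemma differentiable_fst t : differentiable (fst : fn K) t.
Proof. by apply: linear_differentiable => ?; exact: cvg_fst. Qed.

Lemma differentiable_snd t : differentiable (snd : fn K) t.
Proof. by apply: linear_differentiable => ?; exact: cvg_snd. Qed.

Lemma derive_fst v t : 'D_v (fst : fn K) t = v.1.
Proof.
by rewrite deriveE ?diff_lin//; [move=> ?; exact: cvg_fst|exact: differentiable_fst].
Qed.

Lemma derive_snd v t : 'D_v (snd : fn K) t = v.2.
Proof.
by rewrite deriveE ?diff_lin//; [move=> ?; exact: cvg_snd|exact: differentiable_snd].
Qed.

Lemma smooth_on_differentiable U f t : smooth_on U f -> U t -> differentiable f t.
Proof. by move=> /(_ [::] t). Qed.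

Lemma smooth_on_pd1 U f : smooth_on U f -> smooth_on U (pd1 f).
Proof. by move=> sf; apply/smooth_onP => k; have /smooth_onP/(_ k.+1)[_ []] := sf. Qed.

Lemma smooth_on_pd2 U f : smooth_on U f -> smooth_on U (pd2 f).
Proof. by move=> sf; apply/smooth_onP => k; have /smooth_onP/(_ k.+1)[_ []] := sf. Qed.

Lemma smooth_on_add U f g : open U -> smooth_on U f -> smooth_on U g ->
  smooth_on U (fun t => f t + g t).
Proof. by move=> oU /smooth_onP sf /smooth_onP sg; apply/smooth_onP => k; apply: Cn_add. Qed.

Lemma smooth_on_mul U f g : open U -> smooth_on U f -> smooth_on U g ->
  smooth_on U (fun t => f t * g t).
Proof. by move=> oU /smooth_onP sf /smooth_onP sg; apply/smooth_onP => k; apply: Cn_mul. Qed.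

Lemma Cn_cst k U (a : K) : Cn k U (fun=> a).
Proof.
elim: k a => [|k IHk] a; split=> //.
by split; [rewrite (_ : pd1 _ = fun=> 0)|rewrite (_ : pd2 _ = fun=> 0)] => //;
  apply/funext => t; exact: derive_cst.
Qed.

Lemma smooth_on_cst U (a : K) : smooth_on U (fun=> a).
Proof. by apply/smooth_onP => k; exact: Cn_cst. Qed.

Lemma smooth_on_opp U f : open U -> smooth_on U f -> smooth_on U (fun t => - f t).
Proof.
move=> oU sf; rewrite (_ : (fun t => - f t) = fun t => - 1 * f t); last first.
  by apply/funext => t; rewrite mulN1r.
exact: smooth_on_mul oU (@smooth_on_cst _ _) sf.
Qed.

Lemma smooth_on_fst U : smooth_on U (fst : fn K).
Proof.
apply/smooth_onP => -[|k]; split=> //; try by move=> t _; exact: differentiable_fst.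
by split; [rewrite (_ : pd1 _ = fun=> 1)|rewrite (_ : pd2 _ = fun=> 0)];
  try exact: Cn_cst; apply/funext => t; exact: derive_fst.
Qed.

Lemma smooth_on_snd U : smooth_on U (snd : fn K).
Proof.
apply/smooth_onP => -[|k]; split=> //; try by move=> t _; exact: differentiable_snd.
by split; [rewrite (_ : pd1 _ = fun=> 0)|rewrite (_ : pd2 _ = fun=> 1)];
  try exact: Cn_cst; apply/funext => t; exact: derive_snd.
Qed.

(** Cancels [1 - t2] even on the line [t2 = 1]: that line has no interior, and [f] is continuous. *)
Lemma eq0_off_line U f : open U -> smooth_on U f ->
  (forall t, U t -> (1 - t.2) * f t = 0) -> forall t, U t -> f t = 0.
Proof.
move=> oU sf f0 t Ut; apply/eqP/negP => /negP ft0.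
have cf := differentiable_continuous (smooth_on_differentiable sf Ut).
(* Otherwise t.2 would be locally constant, contradicting d t2 / d t2 = 1. *)
have : 'D_((0 : K), (1 : K)) (snd : fn K) t = 'D_((0 : K), (1 : K)) (cst (1 : K)) t.
  apply: near_eq_derive; have fn0 : \forall u \near t, f u != 0.
    exact: (@cvgr_neq0 _ _ _ (nbhs t) (nbhs_filter t) f _ cf ft0).
  apply: filterS2 fn0 (open_nbhs_nbhs (conj oU Ut)) => u fu0 Uu.
  by have /eqP := f0 u Uu; rewrite mulf_eq0 (negPf fu0) orbF subr_eq0 eq_sym => /eqP.
by rewrite derive_snd derive_cst => /eqP; rewrite oner_eq0.
Qed.

Lemma t_of_sK t : t.1 != 0 -> t.2 != 0 -> t_of_s (t.1, t.1 / t.2) = t.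
Proof. by move=> t1 t2; rewrite /t_of_s /= invfM invrK mulrA divff ?mul1r -?surjective_pairing. Qed.

Lemma differentiable_ratio s : s.2 != 0 ->
  differentiable (fun u : K * K => u.1 / u.2) s.
Proof.
move=> s2; apply: (@differentiableM _ _ fst (fun u : K * K => u.2^-1)).
  exact: differentiable_fst.
by apply: differentiableV => //; exact: differentiable_snd.
Qed.

Lemma derive_ratio s v : s.2 != 0 ->
  'D_v (fun u : K * K => u.1 / u.2) s = v.1 / s.2 - s.1 * v.2 / s.2 ^+ 2.
Proof.
move=> s2; have ds := @differentiable_snd s.
rewrite (@derive_mul K fst (fun u => u.2^-1)); last first.
- exact: differentiableV.
- exact: differentiable_fst.
rewrite derive_fst (@deriveV _ _ snd) ?derive_snd//; last exact: diff_derivable.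
by rewrite /GRing.scale /=; field.
Qed.

Lemma differentiable_t_of_s s : s.2 != 0 -> differentiable (@t_of_s K) s.
Proof.
move=> s2; apply: differentiable_pair; first exact: differentiable_fst.
exact: differentiable_ratio.
Qed.

Lemma diff_t_of_s s v : s.2 != 0 ->
  'd (@t_of_s K) s v = (v.1, v.1 / s.2 - s.1 * v.2 / s.2 ^+ 2).
Proof.
move=> s2; have df := @differentiable_fst s; have dr := differentiable_ratio s2.
by rewrite diff_pair// -!deriveE// derive_fst derive_ratio.
Qed.

Lemma derive_comp_t_of_s g s v : s.2 != 0 -> differentiable g (t_of_s s) ->
  'D_v (fun u => g (t_of_s u)) s = v.1 * pd1 g (t_of_s s)
    + (v.1 / s.2 - s.1 * v.2 / s.2 ^+ 2) * pd2 g (t_of_s s).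
Proof.
move=> s2 dg; have dT := differentiable_t_of_s s2.
rewrite deriveE; last exact: (differentiable_comp dT dg).
by rewrite (diff_comp dT dg) /= diff_t_of_s// diff_pdE.
Qed.


Lemma derive_fst_mul p v t : differentiable p t ->
  'D_v (fun u : K * K => u.1 * p u) t = v.1 * p t + t.1 * 'D_v p t.
Proof.
move=> dp; rewrite (derive_mul v (differentiable_fst t) dp) derive_fst.
by rewrite addrC [p t * _]mulrC.
Qed.

Lemma derive_snd_mul p v t : differentiable p t ->
  'D_v (fun u : K * K => u.2 * p u) t = v.2 * p t + t.2 * 'D_v p t.
Proof.
move=> dp; rewrite (derive_mul v (differentiable_snd t) dp) derive_snd.
by rewrite addrC [p t * _]mulrC.
Qed.

Lemma derive_cst_mul (a : K) p v t : differentiable p t ->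
  'D_v (fun u : K * K => a * p u) t = a * 'D_v p t.
Proof.
move=> dp; rewrite (derive_mul v (differentiable_cst a t) dp) derive_cst.
by rewrite mulr0 addr0.
Qed.

(** * Conjugation by the branch [w] of [t2^b'] *)

Section Transform.
Variables (U : set (K * K)) (b' : K) (w : fn K).
Hypothesis oU : open U.
Hypothesis U0 : forall t, U t -> t.1 != 0 /\ t.2 != 0.
Hypothesis sw : smooth_on U w.
Hypothesis w1 : forall t, U t -> pd1 w t = 0.
Hypothesis w2 : forall t, U t -> t.2 * pd2 w t = b' * w t.

Let V := [set s : K * K | [/\ s.1 != 0, s.2 != 0 & U (t_of_s s)]].

(** [F] lives in the [s] variables and [g] in the [t] variables; each operator applied to [F] will
    correspond to its transform applied to [g]. *)
Definition twisted_pullback (F g : fn K) :=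
  forall s, V s -> F s = w (t_of_s s) * g (t_of_s s).

Lemma near_V s : V s -> \forall u \near s, V u.
Proof.
case=> s1 s2 Us.
have cT := differentiable_continuous (differentiable_t_of_s s2).
have : \forall u \near s, U (t_of_s u).
  exact: (cT _ (open_nbhs_nbhs (conj oU Us))).
apply: filterS => u Uu; have [/= u1 u2] := U0 Uu; split=> //.
(* Division by zero gives zero, so [u.2 = 0] would put [t_of_s u] on the line [t.2 = 0], which [U]
   avoids. *)
by apply: contraNneq u2 => ->; rewrite invr0 mulr0.
Qed.

(** The logarithmic derivatives of [w] are [0] and [b' / t2], so [w] factors out of the product rule
    and leaves [pd2 + b' / t2] in place of [pd2]. *)
Lemma twisted_pullback_derive F g s v : twisted_pullback F g -> smooth_on U g ->
  V s -> 'D_v F s = w (t_of_s s) * (v.1 * pd1 g (t_of_s s)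
    + (v.1 / s.2 - s.1 * v.2 / s.2 ^+ 2) *
      (pd2 g (t_of_s s) + b' / (t_of_s s).2 * g (t_of_s s))).
Proof.
move=> Fg sg Vs; have [s1 s2 Us] := Vs; have [t1 t2] := U0 Us.
have dw := smooth_on_differentiable sw Us.
have dg := smooth_on_differentiable sg Us.
rewrite (@near_eq_derive _ _ _ F (fun u => w (t_of_s u) * g (t_of_s u))).
  rewrite derive_mul; [|exact: differentiable_comp (differentiable_t_of_s s2) dw
    |exact: differentiable_comp (differentiable_t_of_s s2) dg].
  rewrite !derive_comp_t_of_s// w1//.
  rewrite (_ : pd2 w (t_of_s s) = b' / (t_of_s s).2 * w (t_of_s s)); last first.
    by rewrite mulrAC -w2// mulrC mulKf.
  ring.
by apply: filterS (near_V Vs) => u /Fg.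
Qed.

Lemma twisted_pullback_euler1 F g : twisted_pullback F g -> smooth_on U g ->
  twisted_pullback (euler1 F)
    (fun t => t.1 * pd1 g t + t.2 * pd2 g t + b' * g t).
Proof.
move=> Fg sg s Vs; have [s1 s2 Us] := Vs.
rewrite /euler1 /pd1 (twisted_pullback_derive _ Fg sg Vs) /=.
rewrite -/(pd1 g _); field; by rewrite s1 s2.
Qed.

Lemma twisted_pullback_euler2 F g : twisted_pullback F g -> smooth_on U g ->
  twisted_pullback (euler2 F) (fun t => - (t.2 * pd2 g t + b' * g t)).
Proof.
move=> Fg sg s Vs; have [s1 s2 Us] := Vs.
rewrite /euler2 {1}/pd2 (twisted_pullback_derive _ Fg sg Vs) /=.
field; by rewrite s1 s2.
Qed.

(** The terms [t2 * pd2 g + b' * g] coming from [euler1] and [euler2] cancel, hence no trace of [b']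
    is left. *)
Lemma twisted_pullback_shift_Dsum F g a : twisted_pullback F g -> smooth_on U g ->
  twisted_pullback (op_shift (@Dsum K) a F) (op_shift (@euler1 K) a g).
Proof.
move=> Fg sg s Vs; rewrite /op_shift /Dsum /op_add.
rewrite (twisted_pullback_euler1 Fg sg Vs) (twisted_pullback_euler2 Fg sg Vs).
by rewrite (Fg s Vs) /euler1; ring.
Qed.

Lemma smooth_on_shift_euler1 g a : smooth_on U g ->
  smooth_on U (op_shift (@euler1 K) a g).
Proof.
move=> sg; apply: smooth_on_add oU _ _; apply: smooth_on_mul oU _ _ => //.
- exact: smooth_on_fst.
- exact: smooth_on_pd1.
- exact: smooth_on_cst.
Qed.

(** Smoothness is carried through the induction because each further factor differentiates the
    previous product. *)
Lemma twisted_pullback_prod n (a : 'I_n -> K) F g :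
  twisted_pullback F g -> smooth_on U g ->
  twisted_pullback (op_prod (fun i => op_shift (@Dsum K) (a i)) F)
    (op_prod (fun i => op_shift (@euler1 K) (a i)) g) /\
  smooth_on U (op_prod (fun i => op_shift (@euler1 K) (a i)) g).
Proof.
move=> Fg sg; rewrite /op_prod; elim: (enum _) => [|i l [IH1 IH2]] /=.
  by split.
by split; [exact: twisted_pullback_shift_Dsum|exact: smooth_on_shift_euler1].
Qed.

(** * The operators of both systems compared *)

Variables (n : nat) (b c : 'I_n -> K) (c' : K) (z y : fn K).
Hypothesis sz : smooth_on U z.
Hypothesis wz : twisted_pullback y z.
Hypothesis symz : forall t, U t -> pd2 (pd1 z) t = pd1 (pd2 z) t.
Hypothesis w0 : forall t, U t -> w t != 0.

Let P := prod_b b z.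
Let Q := prod_c c z.

(** The shifts absorb the [b'] of the conjugation: [D1 + beta1] becomes [theta_1 + theta_2 + c'] and
    [D2 + beta2] becomes [-theta_2], whose factor [t2] cancels against [s2 = t1 / t2]. *)
Let m1 t := t.1 * (t.1 * pd1 P t + t.2 * pd2 P t + c' * P t)
  - (t.1 * pd1 Q t + t.2 * pd2 Q t + b' * Q t).
Let m2 t := - (t.1 * pd2 P t) + (t.2 * pd2 Q t + b' * Q t).
(** [E] and [N] are the transforms of [euler1 y] and [euler2 y]. *)
Let E t := t.1 * pd1 z t + t.2 * pd2 z t + b' * z t.
Let N t := - (t.2 * pd2 z t + b' * z t).
Let m3 t := t.1 * (t.1 * pd1 N t + t.2 * pd2 N t + c' * N t) + t.1 * pd2 E t.

Let pullP : twisted_pullback (prod_alpha b y) P.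
Proof. exact: (twisted_pullback_prod _ wz sz).1. Qed.
Let pullQ : twisted_pullback (prod_gamma c y) Q.
Proof. exact: (twisted_pullback_prod _ wz sz).1. Qed.
Let sP : smooth_on U P.
Proof. exact: (twisted_pullback_prod _ wz sz).2. Qed.
Let sQ : smooth_on U Q.
Proof. exact: (twisted_pullback_prod _ wz sz).2. Qed.
Let sN : smooth_on U N.
Proof.
have [sz2 s2] := (smooth_on_pd2 sz, @smooth_on_snd U).
apply: smooth_on_opp oU _; apply: smooth_on_add oU _ _; apply: smooth_on_mul oU _ _ => //.
exact: smooth_on_cst.
Qed.
Let sE : smooth_on U E.
Proof.
have [[sz1 s1] [sz2 s2]] := ((smooth_on_pd1 sz, @smooth_on_fst U),
  (smooth_on_pd2 sz, @smooth_on_snd U)).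
apply: smooth_on_add oU _ _; first apply: smooth_on_add oU _ _;
  apply: smooth_on_mul oU _ _ => //.
exact: smooth_on_cst.
Qed.

Let sm2 : smooth_on U m2.
Proof.
have [[sP2 s1] [sQ2 s2]] := ((smooth_on_pd2 sP, @smooth_on_fst U),
  (smooth_on_pd2 sQ, @smooth_on_snd U)).
apply: smooth_on_add oU _ _; first apply: smooth_on_opp oU _;
  first exact: smooth_on_mul.
apply: smooth_on_add oU _ _; apply: smooth_on_mul oU _ _ => //.
exact: smooth_on_cst.
Qed.

Let sm3 : smooth_on U m3.
Proof.
have [[s1 s2] [sN1 sN2]] := ((@smooth_on_fst U, @smooth_on_snd U),
  (smooth_on_pd1 sN, smooth_on_pd2 sN)).
have [sE2 sc] := (smooth_on_pd2 sE, @smooth_on_cst U c').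
by do ![apply: smooth_on_add oU _ _ | apply: smooth_on_mul oU _ _ => //].
Qed.

Lemma sys2_M1_pullback : twisted_pullback (sys2_M1 b c (c' - b') y) m1.
Proof.
move=> s Vs; rewrite /sys2_M1 /op_sub /op_lmul /= /op_shift.
rewrite (twisted_pullback_euler1 pullP sP Vs) (twisted_pullback_euler1 pullQ sQ Vs).
by rewrite pullP// /m1 /=; ring.
Qed.

Lemma sys2_M2_pullback : twisted_pullback (sys2_M2 b c b' y) m2.
Proof.
move=> s Vs; have [s1 s2 Us] := Vs; rewrite /sys2_M2 /op_sub /op_lmul /= /op_shift.
rewrite (twisted_pullback_euler2 pullP sP Vs) (twisted_pullback_euler2 pullQ sQ Vs).
by rewrite pullP// /m2 /=; field.
Qed.

Lemma sys2_M3_pullback : twisted_pullback (sys2_M3 (c' - b') b' y) m3.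
Proof.
move=> s Vs; have [s1 s2 Us] := Vs; rewrite /sys2_M3 /op_sub /op_lmul /= /op_shift.
have pullE := twisted_pullback_euler1 wz sz; have pullN := twisted_pullback_euler2 wz sz.
rewrite (twisted_pullback_euler1 pullN sN Vs) (twisted_pullback_euler2 pullE sE Vs).
rewrite pullN// pullE// -/(E _) -/(N _) /m3 /=; field.
exact: s2.
Qed.

Let dz t (Ut : U t) := smooth_on_differentiable sz Ut.
Let dz1 t (Ut : U t) := smooth_on_differentiable (smooth_on_pd1 sz) Ut.
Let dz2 t (Ut : U t) := smooth_on_differentiable (smooth_on_pd2 sz) Ut.

(** Since [delta2 = theta_2 - pd2], adding [m2] supplies the missing [- t1 * pd2 P] and removes
    [theta_2 + b'] from [Q]. *)
Lemma sys1_L1E t : U t -> sys1_L1 b c c' z t = m1 t + m2 t.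
Proof.
move=> Ut; rewrite /sys1_L1 /op_sub /op_lmul /= /op_shift /op_add -/P -/Q.
by rewrite /euler1 /delta2 /m1 /m2; ring.
Qed.

(** The operator [- delta2] is itself [(1 - t2) * pd2], so [1 - t2] splits off from every term. *)
Lemma sys1_L3E t : U t -> sys1_L3 b c b' z t = (1 - t.2) * m2 t.
Proof.
move=> Ut; rewrite /sys1_L3 /op_add /op_sub /op_lmul /= /op_shift -/P -/Q.
by rewrite /delta2 /m2; ring.
Qed.

Lemma derive_delta2_shift a v t : U t -> 'D_v (op_shift (@delta2 K) a z) t =
  v.2 * pd2 z t + (t.2 - 1) * 'D_v (pd2 z) t + a * 'D_v z t.
Proof.
move=> Ut; have [d0 d2 ds] := And3 (dz Ut) (dz2 Ut) (@differentiable_snd t).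
have dk : differentiable (fun u : K * K => u.2 - 1 : K) t.
  exact: differentiableD ds (differentiable_cst _ _).
rewrite /op_shift /delta2 derive_add.
- rewrite !derive_mul// derive_add// derive_snd !derive_cst; ring.
- exact: differentiableM.
- exact: differentiableM.
Qed.

Lemma derive_E v t : U t -> 'D_v E t =
  v.1 * pd1 z t + t.1 * 'D_v (pd1 z) t + (v.2 * pd2 z t + t.2 * 'D_v (pd2 z) t)
    + b' * 'D_v z t.
Proof.
move=> Ut; have [d0 d1 d2] := And3 (dz Ut) (dz1 Ut) (dz2 Ut).
have d3 := differentiableM (differentiable_fst t) d1.
have d4 := differentiableM (differentiable_snd t) d2.
have d5 := differentiableM (differentiable_cst b' t) d0.
rewrite -(derive_fst_mul v d1) -(derive_snd_mul v d2) -(derive_cst_mul b' v d0).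
rewrite -(derive_add v d3 d4).
exact: (derive_add v (differentiableD d3 d4) d5).
Qed.

Lemma derive_N v t : U t -> 'D_v N t =
  - (v.2 * pd2 z t + t.2 * 'D_v (pd2 z) t + b' * 'D_v z t).
Proof.
move=> Ut; have [d0 d2] := (dz Ut, dz2 Ut).
have d4 := differentiableM (differentiable_snd t) d2.
have d5 := differentiableM (differentiable_cst b' t) d0.
rewrite -(derive_snd_mul v d2) -(derive_cst_mul b' v d0).
rewrite -(derive_add v d4 d5).
by apply: deriveN; apply: diff_derivable; exact: differentiableD.
Qed.

Lemma sys1_L2E t : U t -> t.1 * sys1_L2 b' c' z t = - (1 - t.2) * m3 t.
Proof.
move=> Ut.
have D1 a : pd1 (op_shift (@delta2 K) a z) t =
    (t.2 - 1) * pd1 (pd2 z) t + a * pd1 z t.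
  by rewrite {1}/pd1 derive_delta2_shift// mul0r add0r.
have D2 a : pd2 (op_shift (@delta2 K) a z) t =
    pd2 z t + (t.2 - 1) * pd2 (pd2 z) t + a * pd2 z t.
  by rewrite {1}/pd2 derive_delta2_shift// mul1r.
have N1 : pd1 N t = - (t.2 * pd1 (pd2 z) t + b' * pd1 z t).
  by rewrite {1}/pd1 derive_N// mul0r add0r.
have N2 : pd2 N t = - (pd2 z t + t.2 * pd2 (pd2 z) t + b' * pd2 z t).
  by have := derive_N (0, 1) Ut; rewrite /= mul1r.
(* Only here does [pd2 (pd1 z)] appear; symmetry rewrites it as [pd1 (pd2 z)]. *)
have E2 : pd2 E t = t.1 * pd1 (pd2 z) t + (pd2 z t + t.2 * pd2 (pd2 z) t) + b' * pd2 z t.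
  by rewrite {1}/pd2 derive_E// mul0r add0r mul1r -(symz Ut).
rewrite /m3 N1 N2 E2.
transitivity (t.1 * ((1 - t.2) * (t.1 * pd1 (op_shift (@delta2 K) b' z) t
    + (t.2 - 1) * pd2 (op_shift (@delta2 K) b' z) t
    + c' * op_shift (@delta2 K) b' z t)
  - (t.2 - 1) * pd2 (op_shift (@delta2 K) (c' - 1) z) t)); first by [].
rewrite !D1 !D2; exact: second_order_identity.
Qed.

(** Forwards, [L3] gives [m2 = 0] and [L2] gives [m3 = 0] after cancelling [1 - t2], then [L1]
    leaves [m1 = 0]. Backwards, the nonzero factors [w] and [t1] are cancelled. *)
Lemma solves3_transform :
  solves3 (sys1_L1 b c c') (sys1_L2 b' c') (sys1_L3 b c b') U z <->
  solves3 (sys2_M1 b c (c' - b')) (sys2_M2 b c b') (sys2_M3 (c' - b') b') V y.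
Proof.
split=> sol.
  have m20 : forall t, U t -> m2 t = 0.
    apply: eq0_off_line oU sm2 _ => t Ut.
    by rewrite -sys1_L3E//; case: (sol t Ut).
  have m30 : forall t, U t -> m3 t = 0.
    apply: eq0_off_line oU sm3 _ => t Ut.
    apply/eqP; rewrite -oppr_eq0 -mulNr -sys1_L2E//.
    by have [_ -> _] := sol t Ut; rewrite mulr0.
  move=> s Vs; have [_ _ Us] := Vs.
  rewrite sys2_M1_pullback// sys2_M2_pullback// sys2_M3_pullback//.
  rewrite m20// m30// mulr0; split=> //.
  by have [L1 _ _] := sol _ Us; rewrite sys1_L1E// m20// addr0 in L1; rewrite L1 mulr0.
move=> t Ut; have [t1 t2] := U0 Ut.
have tE := t_of_sK t1 t2.
(* Every point [t] of [U] comes from a point of [V], so no equation is lost. *)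
have Vs : V (t.1, t.1 / t.2).
  by split; rewrite ?tE//= mulf_neq0// invr_neq0.
have [] := sol _ Vs.
rewrite sys2_M1_pullback// sys2_M2_pullback// sys2_M3_pullback// tE.
have cancel_w x : w t * x = 0 -> x = 0.
  by move=> /eqP; rewrite mulf_eq0 (negPf (w0 Ut)) => /eqP.
move=> /cancel_w M1 /cancel_w M2 /cancel_w M3; split.
- by rewrite sys1_L1E// M1 M2 addr0.
- by apply: (mulfI t1); rewrite sys1_L2E// M3 !mulr0.
- by rewrite sys1_L3E// M2 mulr0.
Qed.

End Transform.
End ChangeOfVariables.

(* U : open domain of the t-variables (with t1, t2 <> 0 so that s2 = t1/t2
   is defined); w : a (holomorphic, nonvanishing) branch of t2^(b') on U,
   characterized by d w/d t1 = 0 and t2 d w/d t2 = b' w; z : a holomorphic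
   (smooth) function on U; y(s1,s2) = t2^(b') z(t1,t2) with t1 = s1,
   t2 = s1/s2, on the corresponding s-domain. *)
Theorem theorem6p1 (R : realType) (n : nat) (hn : (0 < n)%N)
  (b c : 'I_n -> Cplx R) (b' c' : Cplx R)
  (U : set (Cplx R * Cplx R)) (hU : open U)
  (hU0 : forall t, U t -> t.1 != 0 /\ t.2 != 0)
  (w : Cplx R * Cplx R -> Cplx R) (hws : smooth_on U w)
  (hw0 : forall t, U t -> w t != 0)
  (hw1 : forall t, U t -> pd1 w t = 0)
  (hw2 : forall t, U t -> t.2 * pd2 w t = b' * w t)
  (z : Cplx R * Cplx R -> Cplx R) (hz : smooth_on U z) :
  let alpha := b in
  let gamma := c in
  let beta1 := c' - b' in
  let beta2 := b' in
  let V := [set s : Cplx R * Cplx R | [/\ s.1 != 0, s.2 != 0 & U (t_of_s s)]] in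
  let y := fun s => w (t_of_s s) * z (t_of_s s) in
  solves3 (sys1_L1 b c c') (sys1_L2 b' c') (sys1_L3 b c b') U z <->
  solves3 (sys2_M1 alpha gamma beta1) (sys2_M2 alpha gamma beta2)
          (sys2_M3 beta1 beta2) V y.
Proof.
move=> alpha gamma beta1 beta2 V y.
(* Products carry the maximum norm, so the coordinate directions meet the norm bounds of
   [derive_sym]. *)
have norm10 : `|((1 : Cplx R), (0 : Cplx R))| <= 1.
  by rewrite prod_normE /= normr1 normr0 /Num.max ltr10.
have norm01 : `|((0 : Cplx R), (1 : Cplx R))| <= 1.
  by rewrite prod_normE /= normr1 normr0 /Num.max ltr01.
have symz t : U t -> pd2 (pd1 z) t = pd1 (pd2 z) t.
  move=> Ut; apply: (derive_sym norm10 norm01).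
  - by apply: filterS (open_nbhs_nbhs (conj hU Ut)) => u /(hz [::]).
  - exact: hz [:: false] t Ut.
  - exact: hz [:: true] t Ut.
have wz : twisted_pullback U w y z by [].
exact: (solves3_transform hU hU0 hws hw1 hw2 b c c' hz wz symz hw0).
Qed.
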